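(* Let $(N,R)\in YB(\mathrm{Mat})$. Suppose that $Q\in\mathrm{Aut}_{YB}(N,R)$, and define $S=(\mathrm{Id}_N\otimes Q)\,R\,(\mathrm{Id}_N\otimes Q^{-1})$. Then $R$ and $S$ are $\infty$-equivalent.
   Context: $(N,R)\in YB(\mathrm{Mat})$ means $N\ge 1$ and $R$ is an invertible complex $N^2\times N^2$ matrix, acting on $\mathbb{C}^N\otimes\mathbb{C}^N$, satisfying $(R\otimes \mathrm{Id}_N)(\mathrm{Id}_N\otimes R)(R\otimes \mathrm{Id}_N)=(\mathrm{Id}_N\otimes R)(R\otimes \mathrm{Id}_N)(\mathrm{Id}_N\otimes R)$. $\mathrm{Aut}_{YB}(N,R)$ is the group of invertible $N\times N$ matrices $Q$ such that $Q\otimes Q$ commutes with $R$. For $(N,R)\in YB(\mathrm{Mat})$ and $n\ge1$, $\rho_n^R$ is the representation of the braid group $B_n$ (standard generators $\sigma_1,\ldots,\sigma_{n-1}$) on $(\mathbb{C}^N)^{\otimes n}$ given by $\rho_n^R(\sigma_i)=\mathrm{Id}_N^{\otimes(i-1)}\otimes R\otimes\mathrm{Id}_N^{\otimes(n-i-1)}$. For $S$ as in the claim it is known that $(N,S)\in YB(\mathrm{Mat})$ as well. $R$ and $S$ are $\infty$-equivalent if for every $n\ge1$ there is an invertible matrix $T_n$ with $T_n\rho_n^S(\beta)=\rho_n^R(\beta)T_n$ for all $\beta\in B_n$ (no relation among the $T_n$ for different $n$ is required). *)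

(* Defs.v *)
From HB Require Import structures.
From mathcomp Require Import all_boot all_order all_algebra.
From mathcomp Require Import mxtens complex boolp reals.

Set Implicit Arguments.
Unset Strict Implicit.
Unset Printing Implicit Defensive.
Set Warnings "-redundant-canonical-projection".

Import GRing.Theory.
Local Open Scope ring_scope.

Section YangBaxter.
Variables (F : fieldType) (N : nat).
Implicit Types (R : 'M[F]_(N * N)) (Q : 'M[F]_N).

(* [mxtens] orders the basis of a tensor product lexicographically, so the
   Kronecker product is associative on the nose: casting along an equality of
   dimensions is the usual identification of iterated tensor products. *)
Definition YB_eqn R : Prop :=
  let R12 : 'M_(N * N * N) := R *t (1%:M : 'M_N) in
  let R23 : 'M_(N * N * N) :=
    castmx (mulnA N N N, mulnA N N N) ((1%:M : 'M_N) *t R) in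
  R12 *m R23 *m R12 = R23 *m R12 *m R23.

Definition YBMat R : Prop := [/\ (0 < N)%N, R \in unitmx & YB_eqn R].

Definition AutYB R Q : Prop :=
  Q \in unitmx /\ comm_mx (Q *t Q) R.

End YangBaxter.

Section BraidGroup.
Variable n : nat.

(* The generator s_(i+1) of the braid group on n strands is indexed by
   i : 'I_n.-1; the letter (i, b) is s_(i+1) if b = false and its inverse if
   b = true. *)
Definition braid_letter := ('I_n.-1 * bool)%type.
Definition braid_word := seq braid_letter.

Inductive braid_rel : braid_word -> braid_word -> Prop :=
| braid_refl u : braid_rel u u
| braid_sym u v : braid_rel u v -> braid_rel v u
| braid_trans u v w : braid_rel u v -> braid_rel v w -> braid_rel u w
| braid_cat u u' v v' :
    braid_rel u u' -> braid_rel v v' -> braid_rel (u ++ v) (u' ++ v')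
| braid_cancel i b : braid_rel [:: (i, b); (i, ~~ b)] [::]
| braid_far (i j : 'I_n.-1) : (i.+1 < j)%N ->
    braid_rel [:: (i, false); (j, false)] [:: (j, false); (i, false)]
| braid_adj (i j : 'I_n.-1) : (j = i.+1 :> nat) ->
    braid_rel [:: (i, false); (j, false); (i, false)]
              [:: (j, false); (i, false); (j, false)].

Definition braid_relb (u v : braid_word) : bool := `[< braid_rel u v >].

Lemma braid_relb_equiv : equiv_class_of braid_relb.
Proof.
split=> [u|u v|v u w].
- exact/asboolP/braid_refl.
- by apply/asboolP/asboolP=> /braid_sym.
- by move=> /asboolP uv /asboolP vw; apply/asboolP; apply: braid_trans uv vw.
Qed.

Canonical braid_equiv := EquivRelPack braid_relb_equiv.

Definition braid_group := {eq_quot braid_equiv}%qT.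
HB.instance Definition _ := Choice.on braid_group.
HB.instance Definition _ := EqQuotient.on braid_group.

Definition braid_of_word (w : braid_word) : braid_group := (\pi_braid_group w)%qT.

Definition braid_gen (i : 'I_n.-1) : braid_group := braid_of_word [:: (i, false)].

Definition braid_word_inv (w : braid_word) : braid_word :=
  rev [seq (x.1, ~~ x.2) | x <- w].

Definition braid_mul (x y : braid_group) : braid_group :=
  braid_of_word (repr x ++ repr y).
Definition braid_one : braid_group := braid_of_word [::].
Definition braid_inv (x : braid_group) : braid_group :=
  braid_of_word (braid_word_inv (repr x)).

Lemma braid_of_wordP u v : braid_of_word u = braid_of_word v <-> braid_rel u v.
Proof.
split=> [/eqquotP/asboolP //|uv]; by apply/eqquotP/asboolP.
Qed.

Lemma braid_of_word_repr x : braid_of_word (repr x) = x.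
Proof. exact: reprK. Qed.

Lemma repr_braid_of_word w : braid_rel (repr (braid_of_word w)) w.
Proof. by apply/braid_of_wordP; rewrite braid_of_word_repr. Qed.

Lemma braid_of_word_cat u v :
  braid_mul (braid_of_word u) (braid_of_word v) = braid_of_word (u ++ v).
Proof. by apply/braid_of_wordP/braid_cat; exact: repr_braid_of_word. Qed.

Lemma braid_word_invK : involutive braid_word_inv.
Proof.
move=> w; rewrite /braid_word_inv map_rev revK -map_comp -[RHS]map_id.
by apply: eq_map=> -[i b] /=; rewrite negbK.
Qed.

Lemma braid_word_mulV w : braid_rel (w ++ braid_word_inv w) [::].
Proof.
elim: w => [|[i b] w IHw]; first exact: braid_refl.
rewrite /braid_word_inv /= rev_cons -cats1 catA.
apply: braid_trans (braid_cancel i b).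
rewrite -[_ :: (w ++ _) ++ _]/([:: (i, b)] ++ ((w ++ braid_word_inv w) ++ _)).
apply: (@braid_cat _ [:: (i, b)]); first exact: braid_refl.
by apply: (@braid_cat _ [::]) => //; exact: braid_refl.
Qed.

Fact braid_mulA : associative braid_mul.
Proof.
move=> x y z; rewrite -(braid_of_word_repr x) -(braid_of_word_repr y).
by rewrite -(braid_of_word_repr z) !braid_of_word_cat catA.
Qed.

Fact braid_mul1 : left_id braid_one braid_mul.
Proof. by move=> x; rewrite -(braid_of_word_repr x) braid_of_word_cat. Qed.

Fact braid_mulr1 : right_id braid_one braid_mul.
Proof. by move=> x; rewrite -(braid_of_word_repr x) braid_of_word_cat cats0. Qed.

Fact braid_mulrV : right_inverse braid_one braid_inv braid_mul.
Proof.
move=> x; rewrite -{1}(braid_of_word_repr x) braid_of_word_cat.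
exact/braid_of_wordP/braid_word_mulV.
Qed.

Fact braid_mulV : left_inverse braid_one braid_inv braid_mul.
Proof.
move=> x; rewrite -{2}(braid_of_word_repr x) braid_of_word_cat.
apply/braid_of_wordP; rewrite -{2}[repr x]braid_word_invK.
exact: braid_word_mulV.
Qed.

HB.instance Definition _ := isGroup.Build braid_group
  braid_mulA braid_mul1 braid_mulr1 braid_mulV braid_mulrV.

End BraidGroup.

Section BraidRep.
Variables (F : fieldType) (N n : nat).
Implicit Types R : 'M[F]_(N * N).

Fact braid_dim (i : 'I_n.-1) :
  (N ^ i * (N * N) * N ^ (n - i.+2) = N ^ n)%N.
Proof.
have i2n : (i.+2 <= n)%N by case: n i => [[] //|m] i; exact: (ltn_ord i).
by rewrite mulnn -!expnD addn2 subnKC.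
Qed.

Definition rho_gen R (i : 'I_n.-1) : 'M[F]_(N ^ n) :=
  castmx (braid_dim i, braid_dim i)
    ((1%:M : 'M_N) ^t i *t R *t (1%:M : 'M_N) ^t (n - i.+2)).

Definition rho_word R (w : braid_word n) : 'M[F]_(N ^ n) :=
  foldr (fun x A => (if x.2 then invmx (rho_gen R x.1) else rho_gen R x.1) *m A)
        1%:M w.

(* Evaluated on a chosen word for b; when R is in YB(Mat) the choice is
   irrelevant and this is the representation of the braid group sending
   braid_gen i to rho_gen R i: see rho_of_word, rhoM and rho_braid_gen. *)
Definition rho R (b : braid_group n) : 'M[F]_(N ^ n) := rho_word R (repr b).

End BraidRep.

(* Equality of square matrices up to a cast along an equality of dimensions. *)
Section CastEquality.
Variable F : fieldType.

Definition mxcasteq m p (A : 'M[F]_m) (B : 'M[F]_p) : Prop :=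
  exists e : m = p, castmx (e, e) A = B.

Lemma mxcasteq_refl m (A : 'M[F]_m) : mxcasteq A A.
Proof. by exists erefl; rewrite castmx_id. Qed.

Lemma mxcasteq_sym m p (A : 'M[F]_m) (B : 'M[F]_p) :
  mxcasteq A B -> mxcasteq B A.
Proof. by case=> e <-; case: p / e B => _; exists erefl; rewrite !castmx_id. Qed.

Lemma mxcasteq_trans m p q (A : 'M[F]_m) (B : 'M[F]_p) (C : 'M[F]_q) :
  mxcasteq A B -> mxcasteq B C -> mxcasteq A C.
Proof.
by move=> [e1 <-] [e2 <-]; exists (etrans e1 e2); rewrite castmx_comp.
Qed.

Lemma mxcasteq_eq m (A B : 'M[F]_m) : mxcasteq A B -> A = B.
Proof. by case=> e <-; rewrite castmx_id. Qed.

Lemma mxcasteq_cast m p (e e' : m = p) (A : 'M[F]_m) :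
  mxcasteq (castmx (e, e') A) A.
Proof.
rewrite (nat_irrelevance e' e); apply: mxcasteq_sym; by exists e.
Qed.

Lemma mxcasteq_one m p : m = p -> mxcasteq (1%:M : 'M[F]_m) (1%:M : 'M[F]_p).
Proof. by move->; apply: mxcasteq_refl. Qed.

Lemma mxcasteq_tens m m' p p' (A : 'M[F]_m) (A' : 'M[F]_m')
    (B : 'M[F]_p) (B' : 'M[F]_p') :
  mxcasteq A A' -> mxcasteq B B' -> mxcasteq (A *t B) (A' *t B').
Proof.
move=> [e <-] [e' <-]; case: m' / e A' => _; case: p' / e' B' => _.
by rewrite !castmx_id; apply: mxcasteq_refl.
Qed.

Lemma mxcasteq_tensA m n p (A : 'M[F]_m) (B : 'M[F]_n) (C : 'M[F]_p) :
  mxcasteq (A *t (B *t C)) (A *t B *t C).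
Proof.
exists (mulnA m n p); apply/matrixP=> i j; rewrite castmxE.
case: (mxtens_indexP i)=> i' i2; case: (mxtens_indexP i')=> i0 i1.
case: (mxtens_indexP j)=> j' j2; case: (mxtens_indexP j')=> j0 j1.
rewrite !tensmxE.
have E (x : 'I_m) (y : 'I_n) (z : 'I_p) :
    cast_ord (esym (mulnA m n p)) (mxtens_index (mxtens_index (x, y), z)) =
    mxtens_index (x, mxtens_index (y, z)).
  by apply: val_inj=> /=; rewrite mulnDl -mulnA addnA.
by rewrite !E !tensmxE mulrA.
Qed.

Lemma tensmx11 m n : (1%:M : 'M[F]_m) *t (1%:M : 'M[F]_n) = 1%:M.
Proof.
apply/matrixP=> i j.
case: (mxtens_indexP i)=> i0 i1; case: (mxtens_indexP j)=> j0 j1.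
rewrite tensmxE !mxE (can_eq (@mxtens_indexK _ _)) xpair_eqE.
by case: eqP => _; case: eqP => _ /=; rewrite ?mulr1 ?mulr0.
Qed.

Lemma ntensmx1M m k : (1%:M : 'M[F]_m) ^t k = 1%:M.
Proof.
case: k => [|k]; first by rewrite ntensmx0.
elim: k => [//|k IHk]; by rewrite ntensmxSS IHk tensmx11.
Qed.

Lemma castmx_mulM m p (e : m = p) (A B : 'M[F]_m) :
  castmx (e, e) (A *m B) = castmx (e, e) A *m castmx (e, e) B.
Proof. by case: p / e; rewrite !castmx_id. Qed.

Lemma castmx_1M m p (e : m = p) : castmx (e, e) (1%:M : 'M[F]_m) = 1%:M.
Proof. by case: p / e; rewrite castmx_id. Qed.

End CastEquality.

Section BraidRepTheory.
Variables (F : fieldType) (N : nat).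
Implicit Types R : 'M[F]_(N * N).

Lemma rho_genE n R (i : 'I_n.-1) :
  rho_gen R i = castmx (braid_dim N i, braid_dim N i)
    ((1%:M : 'M_(N ^ i)) *t R *t (1%:M : 'M_(N ^ (n - i.+2)))).
Proof. by rewrite /rho_gen !ntensmx1M. Qed.

Lemma rho_genP n R (i : 'I_n.-1) :
  mxcasteq (rho_gen R i)
    ((1%:M : 'M_(N ^ i)) *t R *t (1%:M : 'M_(N ^ (n - i.+2)))).
Proof. by rewrite rho_genE; apply: mxcasteq_cast. Qed.

Lemma rho_gen_mul n R S (i : 'I_n.-1) :
  rho_gen R i *m rho_gen S i = rho_gen (R *m S) i.
Proof. by rewrite !rho_genE -castmx_mulM !tensmx_mul !mulmx1. Qed.

Lemma rho_gen_unit n R (i : 'I_n.-1) :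
  R \in unitmx -> rho_gen R i \in unitmx.
Proof.
move=> uR; have: rho_gen R i *m rho_gen (invmx R) i = 1%:M.
  by rewrite rho_gen_mul mulmxV // rho_genE !tensmx11 castmx_1M.
by case/mulmx1_unit.
Qed.

Lemma rho_gen_far n R (i j : 'I_n.-1) : (i.+1 < j)%N ->
  rho_gen R i *m rho_gen R j = rho_gen R j *m rho_gen R i.
Proof.
move=> ltij; have j2n : (j.+2 <= n)%N.
  by case: n j {ltij i} => [[] //|m] j; exact: (ltn_ord j).
pose a := (N ^ i)%N; pose c := (N ^ (j - i.+2))%N; pose d := (N ^ (n - j.+2))%N.
pose Ai : 'M[F]_(a * (N * N * c * (N * N)) * d) :=
  (1%:M : 'M_a) *t (R *t (1%:M : 'M_c) *t (1%:M : 'M_(N * N))) *t (1%:M : 'M_d).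
pose Aj : 'M[F]_(a * (N * N * c * (N * N)) * d) :=
  (1%:M : 'M_a) *t ((1%:M : 'M_(N * N)) *t (1%:M : 'M_c) *t R) *t (1%:M : 'M_d).
have Hi : mxcasteq Ai (rho_gen R i).
  apply: mxcasteq_sym; apply: mxcasteq_trans (rho_genP R i) _.
  have eb : (N ^ (n - i.+2) = c * (N * N) * d)%N.
    rewrite /c /d mulnn -!expnD; congr (_ ^ _)%N.
    rewrite addn2 -subSn // -subSn ?(leqW ltij) // addnC addnBA ?subnK //.
    by rewrite !ltnS ltnW // ltnW.
  apply: mxcasteq_trans (mxcasteq_tens (mxcasteq_refl _) (mxcasteq_one F eb)) _.
  rewrite -!tensmx11.
  apply: mxcasteq_trans (mxcasteq_tensA _ _ _) _.
  apply: mxcasteq_tens (mxcasteq_refl _).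
  apply: mxcasteq_trans (mxcasteq_sym (mxcasteq_tensA _ _ _)) _.
  apply: mxcasteq_tens (mxcasteq_refl _) _.
  by rewrite tensmx11; rewrite -tensmx11; apply: mxcasteq_tensA.
have Hj : mxcasteq Aj (rho_gen R j).
  apply: mxcasteq_sym; apply: mxcasteq_trans (rho_genP R j) _.
  apply: mxcasteq_tens (mxcasteq_refl _).
  have ea : (N ^ j = a * (N * N * c))%N.
    rewrite /a /c mulnn -!expnD; congr (_ ^ _)%N.
    by rewrite addnA addn2 subnKC.
  apply: mxcasteq_trans (mxcasteq_tens (mxcasteq_one F ea) (mxcasteq_refl _)) _.
  by rewrite tensmx11 -[X in mxcasteq (X *t _) _]tensmx11;
     apply: mxcasteq_sym (mxcasteq_tensA _ _ _).
case: Hi => ei <-; case: Hj => ej <-; rewrite (nat_irrelevance ej ei).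
by rewrite -!castmx_mulM /Ai /Aj !tensmx_mul !(mulmx1, mul1mx).
Qed.

Lemma rho_gen_adj n R (i j : 'I_n.-1) : YB_eqn R -> j = i.+1 :> nat ->
  rho_gen R i *m rho_gen R j *m rho_gen R i =
  rho_gen R j *m rho_gen R i *m rho_gen R j.
Proof.
move=> ybR eij; have j2n : (j.+2 <= n)%N.
  by case: n j {eij i} => [[] //|m] j; exact: (ltn_ord j).
pose a := (N ^ i)%N; pose d := (N ^ (n - j.+2))%N.
pose R12 : 'M_(N * N * N) := R *t (1%:M : 'M_N).
pose R23 : 'M_(N * N * N) :=
  castmx (mulnA N N N, mulnA N N N) ((1%:M : 'M_N) *t R).
pose Ai : 'M[F]_(a * (N * N * N) * d) := (1%:M : 'M_a) *t R12 *t (1%:M : 'M_d).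
pose Aj : 'M[F]_(a * (N * N * N) * d) := (1%:M : 'M_a) *t R23 *t (1%:M : 'M_d).
have Hi : mxcasteq Ai (rho_gen R i).
  apply: mxcasteq_sym; apply: mxcasteq_trans (rho_genP R i) _.
  have eb : (N ^ (n - i.+2) = N * d)%N.
    by rewrite /d -expnS -subSn // eij.
  apply: mxcasteq_trans (mxcasteq_tens (mxcasteq_refl _) (mxcasteq_one F eb)) _.
  rewrite -tensmx11; apply: mxcasteq_trans (mxcasteq_tensA _ _ _) _.
  apply: mxcasteq_tens (mxcasteq_refl _).
  exact: mxcasteq_sym (mxcasteq_tensA _ _ _).
have Hj : mxcasteq Aj (rho_gen R j).
  apply: mxcasteq_sym; apply: mxcasteq_trans (rho_genP R j) _.
  apply: mxcasteq_tens (mxcasteq_refl _).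
  have ea : (N ^ j = a * N)%N by rewrite eij expnSr.
  apply: mxcasteq_trans (mxcasteq_tens (mxcasteq_one F ea) (mxcasteq_refl _)) _.
  rewrite -tensmx11.
  apply: mxcasteq_trans (mxcasteq_sym (mxcasteq_tensA _ _ _)) _.
  apply: mxcasteq_tens (mxcasteq_refl _) _.
  by apply: mxcasteq_sym; apply: mxcasteq_cast.
case: Hi => ei <-; case: Hj => ej <-; rewrite (nat_irrelevance ej ei).
by rewrite -!castmx_mulM /Ai /Aj !tensmx_mul !mulmx1 [in LHS]ybR.
Qed.

Lemma rho_word_cat n R (u v : braid_word n) :
  rho_word R (u ++ v) = rho_word R u *m rho_word R v.
Proof. by elim: u => [|x u IHu] /=; rewrite ?mul1mx // IHu mulmxA. Qed.

Lemma rho_word_rel n R (u v : braid_word n) :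
  YBMat R -> braid_rel u v -> rho_word R u = rho_word R v.
Proof.
move=> [_ uR ybR]; elim=> {u v} //=.
- by move=> u v w _ -> _ ->.
- by move=> u u' v v' _ IHu _ IHv; rewrite !rho_word_cat IHu IHv.
- move=> i b; have uRi := rho_gen_unit i uR.
  by case: b => /=; rewrite mulmx1 ?mulVmx ?mulmxV.
- by move=> i j ltij; rewrite !mulmx1 rho_gen_far.
- by move=> i j eij; rewrite !mulmx1 !mulmxA rho_gen_adj.
Qed.

Lemma rho_of_word n R (w : braid_word n) :
  YBMat R -> rho R (braid_of_word w) = rho_word R w.
Proof. by move=> ybR; apply: rho_word_rel => //; exact: repr_braid_of_word. Qed.

Lemma rho_braid_gen n R (i : 'I_n.-1) :
  YBMat R -> rho R (braid_gen i) = rho_gen R i.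
Proof. by move=> ybR; rewrite rho_of_word //= mulmx1. Qed.

Lemma rho1 n R : YBMat R -> rho R (1%g : braid_group n) = 1%:M.
Proof. by move=> ybR; rewrite [LHS]rho_of_word. Qed.

Lemma rhoM n R (b c : braid_group n) :
  YBMat R -> rho R (b * c)%g = rho R b *m rho R c.
Proof. by move=> ybR; rewrite [LHS]rho_of_word // rho_word_cat. Qed.

Lemma rho_unit n R (b : braid_group n) : YBMat R -> rho R b \in unitmx.
Proof.
move=> ybR; have := rhoM b b^-1%g ybR.
by rewrite mulgV rho1 // => /esym/mulmx1_unit[].
Qed.

Lemma YBMat_twist R (Q : 'M[F]_N) : YBMat R -> AutYB R Q ->
  YBMat (((1%:M : 'M_N) *t Q) *m R *m ((1%:M : 'M_N) *t invmx Q)).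
Proof.
move=> [N0 uR ybR] [uQ comQ].
have QV : Q *m invmx Q = 1%:M by rewrite mulmxV.
have VQ : invmx Q *m Q = 1%:M by rewrite mulVmx.
set S := _ *m _ *m _; pose I : 'M[F]_N := 1%:M.
split=> //.
  rewrite /S !unitmx_mul uR !tensmx_unit ?unitmx1 ?unitmx_inv //; exact: lt0n_neq0.
pose Q2 := Q *m Q; pose V2 := invmx Q *m invmx Q.
have Q2V : Q2 *m V2 = 1%:M by rewrite /Q2 /V2 mulmxA -(mulmxA Q) QV mulmx1.
have V2Q : V2 *m Q2 = 1%:M by rewrite /Q2 /V2 -mulmxA (mulmxA _ Q) VQ mul1mx VQ.
pose e := mulnA N N N.
pose T : 'M_(N * N * N) := I *t Q *t Q2.
pose T' : 'M_(N * N * N) := I *t invmx Q *t V2.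
have T'T : T' *m T = 1%:M by rewrite /T /T' !tensmx_mul V2Q VQ mulmx1 !tensmx11.
have TC : T = castmx (e, e) (I *t (Q *t Q2)).
  by rewrite /T; case: (mxcasteq_tensA I Q Q2) => e' <-; rewrite (nat_irrelevance e' e).
have T'C : T' = castmx (e, e) (I *t (invmx Q *t V2)).
  by rewrite /T'; case: (mxcasteq_tensA I (invmx Q) V2) => e' <-; rewrite (nat_irrelevance e' e).
have S12 : S *t I = T *m (R *t I) *m T'.
  by rewrite /T /T' !tensmx_mul mulmx1 Q2V.
have S23 : castmx (e, e) (I *t S) = T *m castmx (e, e) (I *t R) *m T'.
  rewrite TC T'C -!castmx_mulM !tensmx_mul !mulmx1; congr (castmx _ (_ *t _)).
  have -> : Q *t Q2 = (I *t Q) *m (Q *t Q) by rewrite tensmx_mul mul1mx.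
  have -> : invmx Q *t V2 = (invmx Q *t invmx Q) *m (I *t invmx Q).
    by rewrite tensmx_mul mulmx1.
  rewrite /S -!mulmxA; congr (_ *m _); rewrite mulmxA comQ -mulmxA.
  congr (_ *m _); rewrite mulmxA tensmx_mul QV.
  by rewrite tensmx11 mul1mx.
have K A B : (T *m A *m T') *m (T *m B *m T') = T *m (A *m B) *m T'.
  by rewrite -!mulmxA (mulmxA T' T) T'T mul1mx.
by rewrite /YB_eqn /= -/I -/e S12 S23 !K ybR.
Qed.

End BraidRepTheory.

Definition infty_equivalent (F : fieldType) (N : nat) (R S : 'M[F]_(N * N)) : Prop :=
  forall n : nat, (1 <= n)%N ->
    exists2 T : 'M[F]_(N ^ n), T \in unitmx &
      forall b : braid_group n, T *m rho S b = rho R b *m T.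

(* Main.v *)
Require Import Defs.
From mathcomp Require Import all_boot all_order all_algebra.
From mathcomp Require Import mxtens complex reals.

Import GRing.Theory.
Local Open Scope ring_scope.
Local Open Scope complex_scope.

(** Since Q (x) Q commutes with R, so does Q^k (x) Q^k, and
    Q^k (x) Q^(k+1) = (1 (x) Q)(Q^k (x) Q^k) conjugates R to S for every k.
    Hence the operator 1 (x) Q (x) Q^2 (x) ... (x) Q^(n-1) conjugates every
    generator of the braid group representation of R to that of S. *)

Section TensorFamily.
Set Implicit Arguments.
Unset Strict Implicit.
Variables (F : fieldType) (N : nat).
Implicit Types (f g : nat -> 'M[F]_N) (R S : 'M[F]_(N * N)).

(** The product [f 0 *t ... *t f (n-1)], with factors allowed to vary by position. Each new factor
    is appended on the right, and the cast lands it in dimension [N ^ n], where [rho_gen] lives. *)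
Fixpoint tensfam f n : 'M[F]_(N ^ n) :=
  if n is m.+1 then
    castmx (esym (expnSr N m), esym (expnSr N m)) (tensfam f m *t f m)
  else 1%:M.

Lemma tensfamS f n : mxcasteq (tensfam f n.+1) (tensfam f n *t f n).
Proof. exact: mxcasteq_cast. Qed.

Lemma tensfam_mul f g n :
  tensfam f n *m tensfam g n = tensfam (fun k => f k *m g k) n.
Proof.
elim: n => [|n IHn] /=; first by rewrite mul1mx.
by rewrite -castmx_mulM tensmx_mul IHn.
Qed.

Lemma tensfam1 f n : (forall k, f k = 1%:M) -> tensfam f n = 1%:M.
Proof.
move=> f1; elim: n => [//|n IHn] /=.
by rewrite IHn f1 tensmx11 castmx_1M.
Qed.

Lemma tensfam_unit f n : (forall k, f k \in unitmx) -> tensfam f n \in unitmx.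
Proof.
move=> uf; have: tensfam f n *m tensfam (fun k => invmx (f k)) n = 1%:M.
  by rewrite tensfam_mul tensfam1 // => k; rewrite mulmxV.
by case/mulmx1_unit.
Qed.

Lemma mxcasteq_tensmx1 m (A : 'M[F]_m) : mxcasteq (A *t (1%:M : 'M_1)) A.
Proof.
by exists (muln1 m); rewrite tens_mx_scalar scale1r castmx_comp castmx_id.
Qed.

Lemma tensfam_cat f m p :
  mxcasteq (tensfam f (m + p)) (tensfam f m *t tensfam (fun k => f (m + k)%N) p).
Proof.
elim: p => [|p IHp].
  by rewrite addn0; apply: mxcasteq_sym; apply: mxcasteq_tensmx1.
rewrite addnS; apply: mxcasteq_trans (tensfamS _ _) _.
apply: mxcasteq_trans (mxcasteq_tens IHp (mxcasteq_refl _)) _.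
apply: mxcasteq_trans (mxcasteq_sym (mxcasteq_tensA _ _ _)) _.
apply: mxcasteq_tens (mxcasteq_refl _) _.
exact: mxcasteq_sym (tensfamS _ _).
Qed.

(** Isolates the two adjacent slots on which the generator of index [i] acts, in the same block
    shape as [rho_genE]. *)
Lemma tensfam_split f n (i : 'I_n.-1) :
  mxcasteq (tensfam f n)
    (tensfam f i *t (f i *t f i.+1) *t
     tensfam (fun k => f (i.+2 + k)%N) (n - i.+2)).
Proof.
(* This bound makes the truncated subtraction [n - i.+2] exact. *)
have i2n : (i.+2 <= n)%N by case: n i => [[] //|m] i; exact: (ltn_ord i).
rewrite -[X in mxcasteq (tensfam f X)](subnKC i2n).
apply: mxcasteq_trans (tensfam_cat _ _ _) _.
apply: mxcasteq_tens (mxcasteq_refl _).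
apply: mxcasteq_trans (tensfamS _ _) _.
apply: mxcasteq_trans (mxcasteq_tens (tensfamS _ _) (mxcasteq_refl _)) _.
exact: mxcasteq_sym (mxcasteq_tensA _ _ _).
Qed.

(** The outer blocks of [tensfam f n] only meet identity blocks, so intertwining reduces to the two
    middle slots. *)
Lemma tensfam_rho_gen f R S n (i : 'I_n.-1) :
  (f i *t f i.+1) *m R = S *m (f i *t f i.+1) ->
  tensfam f n *m rho_gen R i = rho_gen S i *m tensfam f n.
Proof.
move=> fRS; rewrite !rho_genE; set e := braid_dim N i.
case/mxcasteq_sym: (tensfam_split f i) => e' <-.
rewrite (nat_irrelevance e' e) -!castmx_mulM !tensmx_mul fRS.
by rewrite !mul1mx !mulmx1.
Qed.

Lemma rho_word_intertwine n R S (T : 'M[F]_(N ^ n)) (w : braid_word n) :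
  R \in unitmx -> S \in unitmx ->
  (forall i : 'I_n.-1, T *m rho_gen R i = rho_gen S i *m T) ->
  T *m rho_word R w = rho_word S w *m T.
Proof.
move=> uR uS TRS; elim: w => [|[i b] w IHw] /=; first by rewrite mulmx1 mul1mx.
rewrite mulmxA -[RHS]mulmxA -IHw [RHS]mulmxA; congr (_ *m _).
case: b => /=; last exact: TRS.
have [uRi uSi] := (rho_gen_unit i uR, rho_gen_unit i uS).
(* For an inverse letter, multiply on the left by [rho_gen S i] and move it through [T], where it
   becomes [rho_gen R i] and cancels. *)
by apply: (canRL (mulKmx uSi)); rewrite mulmxA -TRS mulmxK.
Qed.

Lemma tensmx_exp_comm R (Q : 'M[F]_N) k :
  comm_mx (Q *t Q) R -> comm_mx ((Q ^+ k) *t (Q ^+ k)) R.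
Proof.
move=> QR; elim: k => [|k IHk].
  by rewrite /comm_mx expr0 tensmx11 mul1mx mulmx1.
by rewrite /comm_mx exprS -tensmx_mul -mulmxA IHk mulmxA QR mulmxA.
Qed.

End TensorFamily.

Theorem theorem7p9 (K : realType) (N : nat) (R : 'M[K[i]]_(N * N))
    (Q : 'M[K[i]]_N) (hR : YBMat R) (hQ : AutYB R Q) :
  let S := ((1%:M : 'M_N) *t Q) *m R *m ((1%:M : 'M_N) *t invmx Q) in
  infty_equivalent R S.
Proof.
move=> S n _.
have [_ uS _] : YBMat S := YBMat_twist hR hQ.
have [[_ uR _] [uQ QR]] := (hR, hQ).
pose T := tensfam (fun k => Q ^+ k) n.
have uT : T \in unitmx.
  apply: tensfam_unit; elim=> [|k IHk]; first by rewrite expr0 unitmx1.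
  by rewrite exprS unitmx_mul uQ.
have TRS i : T *m rho_gen R i = rho_gen S i *m T.
  apply: tensfam_rho_gen.
  have -> : Q ^+ i *t Q ^+ i.+1 = (1%:M *t Q) *m (Q ^+ i *t Q ^+ i).
    by rewrite tensmx_mul mul1mx exprS.
  (* Once [R] has passed [Q ^+ i *t Q ^+ i], the factors [1 *t invmx Q] and [1 *t Q] cancel on the
     [S] side. *)
  rewrite /S -!mulmxA (tensmx_exp_comm i QR); congr (_ *m (_ *m _)).
  by rewrite mulmxA tensmx_mul mulVmx // mul1mx tensmx11 mul1mx.
(* [T] carries [rho R] to [rho S]; [infty_equivalent] asks for the opposite direction, hence the
   inverse. *)
exists (invmx T) => [|b]; first by rewrite unitmx_inv.
apply: (canRL (mulmxK uT)); rewrite -mulmxA.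
by rewrite -(@rho_word_intertwine _ _ _ R) // mulKmx.
Qed.
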